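(* Let $(\mathcal{A},\mu)$ be a multiarrangement in $\mathbb{K}^2$ and $\{\theta_1,\theta_2\}$ a homogeneous basis for $D(\mathcal{A},\mu)$ such that $\deg(\theta_1)\ge\deg(\theta_2)$. Fix $\alpha=\alpha_x x+\alpha_y y\in S_1\setminus\{0\}$. Let $\mu'$ be the map with $\mu'(\ker(\alpha))=\mu(\ker(\alpha))+1$ and $\mu'(H)=\mu(H)$ for $H\in\mathcal{A}\setminus\{\ker(\alpha)\}$. Let $\{\theta_1',\theta_2'\}$ be a homogeneous basis for $D(\operatorname{supp}(\mu'),\mu')$. Let $d'=|\deg(\theta_1')-\deg(\theta_2')|$, $d=|\deg(\theta_1)-\deg(\theta_2)|$, and $g=\frac{\theta_2(\alpha)}{\alpha^{\mu(\ker(\alpha))}}$. Then $d'>d$ if $g(\alpha_y,-\alpha_x)=0$ or $d=0$, and $d'<d$ otherwise.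
   Context: Let $\mathbb{K}$ be a field, $V=\mathbb{K}^2$ with coordinates $x,y$, and $S=\mathbb{K}[x,y]=\bigoplus_{i\ge 0}S_i$ graded by degree, so $S_1$ is the space of linear forms. A central arrangement $\mathcal{A}$ is a finite collection of hyperplanes through the origin (i.e. lines through the origin) in $V$. A multiarrangement $(\mathcal{A},\mu)$ is a central arrangement $\mathcal{A}$ with a map $\mu:\mathcal{A}\to\mathbb{Z}_{>0}$; it is identified with the map $\mu$ from all hyperplanes through the origin to $\mathbb{Z}_{\ge 0}$ obtained by setting $\mu(H)=0$ for $H\notin\mathcal{A}$, so that $\mathcal{A}=\operatorname{supp}(\mu)=\{H:\mu(H)\ne 0\}$. The module of logarithmic vector fields $D(\mathcal{A},\mu)$ is the $S$-module of all derivations $\theta=f\partial_x+g\partial_y$ with $f,g\in S$ such that $\theta(\alpha)$ lies in the ideal $(\alpha^{\mu(\ker(\alpha))})$ of $S$ for each $\alpha\in S_1\setminus\{0\}$. It is graded: $D(\mathcal{A},\mu)_i$ consists of those $f\partial_x+g\partial_y\in D(\mathcal{A},\mu)$ with $f,g\in S_i$. A nonzero element of $D(\mathcal{A},\mu)_i$ is homogeneous of degree $i$. A homogeneous basis is an $S$-module basis consisting of (two) homogeneous elements. *)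

(* Defs.v *)
From HB Require Import structures.
From mathcomp Require Import all_boot all_algebra.
From mathcomp Require Import finmap.
From mathcomp Require Import mpoly.

Set Implicit Arguments.
Unset Strict Implicit.
Unset Printing Implicit Defensive.

Import GRing.Theory.
Local Open Scope ring_scope.

(* [linfun] only agrees with its argument when that argument is linear, so the
   definition is meant for linear forms, i.e. for [alpha \is 1.-homog]; see
   [mem_ker_form]. *)
Definition ker_form (K : fieldType) (alpha : {mpoly K[2]}) :
    {vspace 'rV[K]_2} :=
  lker (linfun (fun v : 'rV[K]_2 => (alpha.@[v ord0] : K^o))).

Lemma mem_ker_form (K : fieldType) (alpha : {mpoly K[2]}) (v : 'rV[K]_2) :
  alpha \is 1.-homog -> (v \in ker_form alpha) = (alpha.@[v ord0] == 0).
Proof.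
move=> ha; pose f (w : 'rV[K]_2) : K := alpha.@[w ord0].
have fE w : f w =
    \sum_(m <- msupp alpha) alpha@_m * \sum_(i < 2) (m i)%:R * w ord0 i.
  rewrite /f mevalE; apply: eq_big_seq => m hm; congr (_ * _).
  have /eqP/mdeg1P [i /eqP->] := dhomog_mf ha hm.
  rewrite (bigD1 i) //= [RHS](bigD1 i) //= !mnm1E eqxx expr1 mul1r.
  rewrite big1 => [|j ji]; last by rewrite mnm1E eq_sym (negPf ji) expr0.
  rewrite big1 => [|j ji]; last by rewrite mnm1E eq_sym (negPf ji) mul0r.
  by rewrite mulr1 addr0.
have linf (a : K) (u w : 'rV[K]_2) : f (a *: u + w) = a * f u + f w.
  rewrite !fE [a * _]mulr_sumr -[RHS]big_split /=; apply: eq_bigr => m _.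
  rewrite mulrCA -mulrDr; congr (_ * _).
  rewrite [a * _]mulr_sumr -[RHS]big_split /=; apply: eq_bigr => i _.
  by rewrite !mxE mulrDr mulrCA.
pose lf := GRing.isLinear.Build K 'rV[K]_2 K^o *:%R f
  (linf : linear (f : _ -> K^o)).
pose fL : {linear 'rV[K]_2 -> K^o} := HB.pack f lf.
by rewrite memv_ker (lfunE fL).
Qed.

(* A multiarrangement is identified with its multiplicity map, extended by 0;
   the arrangement itself is [finsupp mu]. *)
Definition multiarrangement (K : fieldType)
    (mu : {fsfun {vspace 'rV[K]_2} -> nat with 0%N}) : Prop :=
  forall H, H \in finsupp mu -> \dim H = 1%N.

Definition incr_mult (K : fieldType)
    (mu : {fsfun {vspace 'rV[K]_2} -> nat with 0%N}) (H : {vspace 'rV[K]_2}) :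
    {fsfun {vspace 'rV[K]_2} -> nat with 0%N} :=
  [fsfun mu with H |-> (mu H).+1].

(* The row (f, g) encodes the derivation f d/dx + g d/dy of K[x, y]. *)
Notation vfield K := 'rV[{mpoly K[2]}]_2.

Definition vf_apply (K : fieldType) (theta : vfield K) (p : {mpoly K[2]}) :
    {mpoly K[2]} :=
  \sum_(i < 2) theta ord0 i * p^`M(i).

Definition log_vfield (K : fieldType)
    (mu : {fsfun {vspace 'rV[K]_2} -> nat with 0%N}) (theta : vfield K) : Prop :=
  forall alpha : {mpoly K[2]}, alpha \is 1.-homog -> alpha != 0 ->
    exists q : {mpoly K[2]},
      vf_apply theta alpha = q * alpha ^+ mu (ker_form alpha).

Definition vf_homog (K : fieldType) (n : nat) (theta : vfield K) : Prop :=
  theta != 0 /\ forall i, theta ord0 i \is n.-homog.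

Definition log_basis (K : fieldType)
    (mu : {fsfun {vspace 'rV[K]_2} -> nat with 0%N})
    (theta1 theta2 : vfield K) : Prop :=
  [/\ log_vfield mu theta1,
      log_vfield mu theta2,
      forall theta : vfield K, log_vfield mu theta ->
        exists p q : {mpoly K[2]}, theta = p *: theta1 + q *: theta2
    & forall p q : {mpoly K[2]},
        p *: theta1 + q *: theta2 = 0 -> p = 0 /\ q = 0].

Definition homog_basis (K : fieldType)
    (mu : {fsfun {vspace 'rV[K]_2} -> nat with 0%N})
    (theta1 theta2 : vfield K) (n1 n2 : nat) : Prop :=
  [/\ log_basis mu theta1 theta2, vf_homog n1 theta1 & vf_homog n2 theta2].

(* Main.v *)
Require Import Defs.
From HB Require Import structures.
From mathcomp Require Import all_boot all_algebra.
From mathcomp Require Import finmap.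
From mathcomp Require Import mpoly.
From mathcomp Require Import ring zify.

Set Implicit Arguments.
Unset Strict Implicit.
Unset Printing Implicit Defensive.

Import GRing.Theory.
Local Open Scope ring_scope.

(** Write [M] for the module of logarithmic vector fields of [mu], [M'] for that
of the incremented multiplicity, and [m] for the multiplicity of the kernel of
[alpha] in [mu]. Only the condition at that kernel changes, so [M'] consists of
the [theta] in [M] such that [alpha ^+ m.+1] divides [theta(alpha)]
([log_vfield_incr]); in other words, it is the kernel of the linear map sending
[theta] to the class of [theta(alpha) / alpha ^+ m] in [S / (alpha)], where [S]
is the polynomial ring.

Hence a basis [(omega1, omega2)] of [M] with [omega1] in [M'] and [omega2]
outside [M'] yields the basis [(omega1, alpha *: omega2)] of [M'], because
[alpha] is prime ([linform_prime], [log_basis_incr]). Everything reduces to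
finding such a homogeneous basis of [M].

- If [g] vanishes at [(ay, - ax)], then [alpha] divides [g], as [g] is
  homogeneous, so [theta2] is in [M']. Then [theta1] is not, for [M'] differs
  from [M] ([incr_mult_proper]). The degrees of the new basis are [n2] and
  [n1 + 1], and the gap is [d + 1].
- Otherwise [theta2] is not in [M']. The homogeneous elements of a given degree
  in [S / (alpha)] form a line ([residue_homog]), so that a homogeneous [h] of
  degree [n1 - n2] can be chosen with [theta1 - h *: theta2] in [M']. The
  degrees of the new basis are [n1] and [n2 + 1], and the gap is [|d - 1|],
  which is 1 if [d] is zero and less than [d] if not.

The given basis of [M'] has the same gap, since the degrees of a homogeneous
basis are determined by the module ([homog_basis_degree_gap]). *)

Section LogFields.

Context (K : fieldType).
Implicit Types (a b c s t : K) (f g h p q : {mpoly K[2]}).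
Implicit Types (theta eta : vfield K) (k m n : nat).
Implicit Types (mu : {fsfun {vspace 'rV[K]_2} -> nat with 0%N}).

(** * Linear forms in two variables *)

Lemma big_ord2 (R : Type) (idx : R) (op : Monoid.law idx) (F : 'I_2 -> R) :
  \big[op/idx]_(i < 2) F i = op (F ord0) (F ord_max).
Proof.
by rewrite big_ord_recr big_ord1; congr (op (F _) _); apply: val_inj.
Qed.

Lemma ord2P (P : 'I_2 -> Prop) : P ord0 -> P ord_max -> forall i, P i.
Proof.
by move=> P0 P1 [[|[|//]] lti]; [move: P0 | move: P1];
  congr (P _); apply: val_inj.
Qed.

Definition linform a b : {mpoly K[2]} := a *: 'X_ord0 + b *: 'X_ord_max.

Definition zero_dir a b : 'rV[K]_2 := \row_i tnth [tuple b; - a] i.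

Lemma zero_dirE a b (i : 'I_1) :
  (zero_dir a b i ord0 = b) * (zero_dir a b i ord_max = - a).
Proof. by rewrite /zero_dir !mxE. Qed.

(** Divisibility in this existential form is what the definition of logarithmic
vector fields unfolds to. *)
Definition mdvd f g : Prop := exists q, g = q * f.

Lemma dhomogXU (i : 'I_2) : ('X_i : {mpoly K[2]}) \is 1.-homog.
Proof. by rewrite dhomogX /= mdeg1. Qed.

Lemma dhomog_linform a b : linform a b \is 1.-homog.
Proof. by apply: rpredD; apply: rpredZ; apply: dhomogXU. Qed.

Lemma dhomog1_linform f :
  f \is 1.-homog -> f = linform f@_U_(ord0) f@_U_(ord_max).
Proof.
move=> hf; apply/mpolyP => m.
rewrite mcoeffD !mcoeffZ !mcoeffX.
have [m1 | m1] := boolP (mdeg m == 1%N).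
  have /mdeg1P[i /eqP->] := m1.
  by elim/ord2P: i; rewrite !eq_mnm1 /= ?mulr1 ?mulr0 ?addr0 ?add0r.
have neU i : (U_(i)%MM == m) = false.
  by apply: contraNF m1 => /eqP<-; rewrite /= mdeg1.
by rewrite (dhomog_nemf_coeff hf m1) !neU !mulr0 addr0.
Qed.

Lemma meval_linform a b (v : 'I_2 -> K) :
  (linform a b).@[v] = a * v ord0 + b * v ord_max.
Proof. by rewrite mevalD !mevalZ !mevalXU. Qed.

Lemma linform_neq0 a b : (linform a b != 0) = (a != 0) || (b != 0).
Proof.
rewrite -negb_and; congr (~~ _); apply/eqP/andP => [e | [/eqP-> /eqP->]].
  have ev v : (linform a b).@[v] = 0 by rewrite e meval0.
  split; apply/eqP.
    move: (ev (fun i => (i == ord0)%:R)).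
    by rewrite meval_linform /= mulr1 mulr0 addr0.
  move: (ev (fun i => (i == ord_max)%:R)).
  by rewrite meval_linform /= mulr1 mulr0 add0r.
by rewrite /linform !scale0r addr0.
Qed.

(** A second form [linform s t] that equals 1 at [zero_dir a b]; together with
[linform a b] it is a system of linear coordinates. *)
Lemma linform_complement a b :
  linform a b != 0 -> exists s t, s * b - t * a = 1.
Proof.
rewrite linform_neq0 => /orP[a0 | b0].
  by exists 0, (- a^-1); rewrite mul0r sub0r mulNr opprK mulVf.
by exists b^-1, 0; rewrite mul0r subr0 mulVf.
Qed.

Lemma linform_coordinates s t a b : s * b - t * a = 1 ->
  (b *: linform s t - t *: linform a b = 'X_ord0) *
  (s *: linform a b - a *: linform s t = 'X_ord_max).
Proof.
move=> e; rewrite /linform; split.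
  rewrite -[RHS]scale1r -e -!mul_mpolyC mpolyCB !mpolyCM; ring.
rewrite -[RHS]scale1r -e -!mul_mpolyC mpolyCB !mpolyCM; ring.
Qed.

(** Reduction modulo [alpha = linform a b], realised inside the polynomial ring:
with [tau = linform s t] normalised as in [linform_complement], one has
'X_ord0 = b tau and 'X_ord_max = - a tau modulo [alpha], and substituting these
values is a ring endomorphism with kernel generated by [alpha]. *)
Definition residue s t a b f : {mpoly K[2]} :=
  f \mPo [tuple b *: linform s t; - a *: linform s t].

Lemma residue_linform s t a b : residue s t a b (linform a b) = 0.
Proof.
rewrite /residue raddfD /= !comp_mpolyZ !comp_mpolyXU /= !scalerA.
by rewrite -scalerDl mulrN mulrC subrr scale0r.
Qed.

(** The polynomials congruent to their residue form a subring, which contains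
the variables. *)
Lemma residue_congr s t a b f : s * b - t * a = 1 ->
  mdvd (linform a b) (f - residue s t a b f).
Proof.
move=> e; set rho := residue s t a b.
have rhoM : {morph rho : x y / x * y} by move=> x y; apply: rmorphM.
have dM x y : mdvd (linform a b) (x - rho x) ->
    mdvd (linform a b) (y - rho y) -> mdvd (linform a b) (x * y - rho (x * y)).
  move=> [q eq] [r er]; exists (q * y + rho x * r).
  by rewrite rhoM mulrDl -(mulrA _ r) -er mulrAC -eq; ring.
elim/mpolyind: f => [|c m f _ _ [q eq]].
  by exists 0; rewrite /rho /residue raddf0 subrr mul0r.
have [r er] : mdvd (linform a b) ('X_[m] - rho 'X_[m]).
  have d1 : mdvd (linform a b) (1 - rho 1).
    by exists 0; rewrite mul0r /rho /residue comp_mpoly1 subrr.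
  have [solX solY] := linform_coordinates e.
  have dX i : mdvd (linform a b) ('X_i - rho 'X_i).
    rewrite /rho /residue comp_mpolyXU; elim/ord2P: i => /=.
      by exists (- t%:MP); rewrite -[in LHS]solX -!mul_mpolyC; ring.
    by exists s%:MP; rewrite -[in LHS]solY -!mul_mpolyC mpolyCN; ring.
  rewrite mpolyXE_id; apply: (big_ind (fun f => mdvd _ (f - rho f))) => // i _.
  by elim: (m i) => [|k IHk]; rewrite ?expr0 // exprS; apply: dM.
exists (c *: r + q); rewrite /rho /residue raddfD /= comp_mpolyZ.
rewrite mulrDl -eq -scalerAl -er /rho /residue -!mul_mpolyC; ring.
Qed.

Lemma residue_eq0 s t a b f : s * b - t * a = 1 ->
  (residue s t a b f = 0) <-> mdvd (linform a b) f.
Proof.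
move=> e; split=> [r0 | [q ->]].
  by have := residue_congr f e; rewrite r0 subr0.
by rewrite /residue rmorphM /= [X in _ * X]residue_linform mulr0.
Qed.

(** The kernel of an endomorphism of a domain is prime. *)
Lemma linform_prime a b f g : linform a b != 0 ->
  mdvd (linform a b) (f * g) -> mdvd (linform a b) f \/ mdvd (linform a b) g.
Proof.
move=> /linform_complement[s [t e]] /(residue_eq0 _ e).
rewrite /residue rmorphM /= => /eqP; rewrite mulf_eq0.
by case/orP=> /eqP /(residue_eq0 _ e); [left | right].
Qed.

(** Modulo the form, the homogeneous polynomials of degree [k] make up a line,
spanned by the power of [linform s t]. *)
Lemma residue_homog s t a b f k : f \is k.-homog ->
  residue s t a b f = f.@[zero_dir a b ord0] *: linform s t ^+ k.
Proof.
move=> hf; rewrite /residue comp_mpolyE mevalE scaler_suml.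
apply: eq_big_seq => m hm.
rewrite -scalerA; congr (_ *: _).
have -> : k = mdeg m by apply/esym/(dhomog_mf hf hm).
rewrite mdegE.
rewrite expr_sum -scaler_prod; apply: eq_bigr => i _.
by rewrite mxE -exprZn; elim/ord2P: i.
Qed.

Lemma meval_zero_dir a b : (linform a b).@[zero_dir a b ord0] = 0.
Proof. by rewrite meval_linform !zero_dirE; ring. Qed.

(** Homogeneity makes vanishing at one nonzero point of the line suffice,
whatever the size of the field. *)
Lemma homog_dvd_root a b f k : linform a b != 0 -> f \is k.-homog ->
  mdvd (linform a b) f <-> f.@[zero_dir a b ord0] = 0.
Proof.
move=> l0 hf; split=> [[q ->] | r0].
  by rewrite mevalM meval_zero_dir mulr0.
have [s [t e]] := linform_complement l0.
by apply/(residue_eq0 _ e); rewrite (residue_homog _ _ _ _ hf) r0 scale0r.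
Qed.

Lemma zero_dirK (v : 'rV[K]_2) : zero_dir (- v ord0 ord_max) (v ord0 ord0) = v.
Proof. by apply/rowP=> i; rewrite mxE; elim/ord2P: i => //=; rewrite opprK. Qed.

Lemma ker_linform a b : linform a b != 0 ->
  ker_form (linform a b) = <[zero_dir a b]>%VS.
Proof.
move=> /linform_complement[s [t e]]; apply/vspaceP => v.
rewrite mem_ker_form ?dhomog_linform //; apply/eqP/vlineP => [|[k ->]].
  rewrite meval_linform; set x := v _ ord0; set y := v _ ord_max => v0.
  exists (s * x + t * y); apply/rowP; elim/ord2P; rewrite mxE zero_dirE.
    rewrite -[LHS]/x.
    transitivity (x * (s * b - t * a) + t * (a * x + b * y)); last by ring.
    by rewrite e v0 mulr1 mulr0 addr0.
  rewrite -[LHS]/y.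
  transitivity (y * (s * b - t * a) - s * (a * x + b * y)); last by ring.
  by rewrite e v0 mulr1 mulr0 subr0.
by rewrite meval_linform mxE zero_dirE mxE zero_dirE; ring.
Qed.

Lemma line_ker_form (H : {vspace 'rV[K]_2}) : \dim H = 1%N ->
  exists a b, linform a b != 0 /\ H = ker_form (linform a b).
Proof.
move=> dH; set v := vpick H.
have v0 : v != 0 by rewrite vpick0 -dimv_eq0 dH.
have HE : H = <[v]>%VS.
  by apply/esym/eqP; rewrite eqEdim -memvE memv_pick dH dim_vline v0.
exists (- v ord0 ord_max), (v ord0 ord0).
have l0 : linform (- v ord0 ord_max) (v ord0 ord0) != 0.
  rewrite linform_neq0 oppr_eq0 -negb_and.
  apply: contra v0 => /andP[/eqP v1 /eqP v0].
  by apply/eqP/rowP => i; rewrite mxE; elim/ord2P: i.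
by rewrite ker_linform // zero_dirK.
Qed.

Lemma vanishing_form_proportional a b f :
  linform a b != 0 -> f \is 1.-homog -> f != 0 ->
  f.@[zero_dir a b ord0] = 0 -> exists2 c, c != 0 & f = c *: linform a b.
Proof.
move=> l0 hf f0 r0; have fE := dhomog1_linform hf.
have [s [t e]] := linform_complement l0.
have [solX solY] := linform_coordinates e.
move: r0 f0; rewrite fE; set x := f@_ _; set y := f@_ _.
rewrite meval_linform !zero_dirE => r0.
(* in the coordinates of the two forms, the first one drops out by [r0] *)
have -> : linform x y = (y * s - x * t) *: linform a b.
  transitivity
    ((x * b + y * - a) *: linform s t + (y * s - x * t) *: linform a b).
    rewrite {1}/linform -[in LHS]solX -[in LHS]solY.
    by rewrite -!mul_mpolyC !(mpolyCD, mpolyCN, mpolyCM); ring.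
  by rewrite r0 scale0r add0r.
move=> c0; exists (y * s - x * t) => //.
by apply: contra c0 => /eqP->; rewrite scale0r.
Qed.

(** * Divisibility *)

Lemma mdvd_mull (f g h : {mpoly K[2]}) : mdvd f g -> mdvd f (h * g).
Proof. by move=> [q ->]; exists (h * q); rewrite mulrA. Qed.

Lemma mdvdD (f g h : {mpoly K[2]}) :
  mdvd f g -> mdvd f h -> mdvd f (g + h).
Proof. by move=> [q ->] [r ->]; exists (q + r); rewrite mulrDl. Qed.

Lemma mdvdDl (f g h : {mpoly K[2]}) :
  mdvd f g -> mdvd f (g + h) -> mdvd f h.
Proof.
by move=> [q ->] [r e]; exists (r - q); rewrite mulrBl -e addrC addKr.
Qed.

Lemma mdvd_expS f g m : f != 0 -> mdvd (f ^+ m.+1) (g * f ^+ m) -> mdvd f g.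
Proof.
move=> f0 [q e]; exists q; apply: (mulIf (expf_neq0 m f0)).
by rewrite -mulrA -exprS.
Qed.

Lemma mdvd_scaleXl c f g m :
  c != 0 -> mdvd (f ^+ m) g -> mdvd ((c *: f) ^+ m) g.
Proof.
move=> c0 [q ->]; exists ((c ^+ m)^-1 *: q).
by rewrite exprZn -scalerAl -scalerAr scalerA mulVf ?scale1r // expf_neq0.
Qed.

(** * Lines and their equations *)

Lemma ker_formZ c f :
  f \is 1.-homog -> c != 0 -> ker_form (c *: f) = ker_form f.
Proof.
move=> hf c0; apply/vspaceP=> v; rewrite !mem_ker_form ?rpredZ //.
by rewrite mevalZ mulf_eq0 (negPf c0).
Qed.

Lemma ker_form_inj a b f : linform a b != 0 -> f \is 1.-homog -> f != 0 ->
  ker_form f = ker_form (linform a b) ->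
  exists2 c, c != 0 & f = c *: linform a b.
Proof.
move=> l0 hf f0 kE; apply: vanishing_form_proportional => //.
by apply/eqP; rewrite -mem_ker_form // kE ker_linform // memv_line.
Qed.

Lemma ker_form_dvd a b f : linform a b != 0 -> f \is 1.-homog -> f != 0 ->
  mdvd (linform a b) f -> ker_form f = ker_form (linform a b).
Proof.
move=> l0 hf f0 /(homog_dvd_root l0 hf) r0.
have [c c0 ->] := vanishing_form_proportional l0 hf f0 r0.
by rewrite ker_formZ // dhomog_linform.
Qed.

(** * Logarithmic vector fields and their bases *)

Lemma vf_applyE theta a b : vf_apply theta (linform a b) =
  a *: theta ord0 ord0 + b *: theta ord0 ord_max.
Proof.
have dX (i j : 'I_2) : ('X_i : {mpoly K[2]})^`M(j) = (i == j)%:R.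
  rewrite mderivX mnm1E; case: eqP => [->|_]; last by rewrite scale0r.
  by rewrite scale1r -[X in (X - _)%MM]add0m addmK mpolyX0.
rewrite /vf_apply big_ord2 /linform !mderivD !mderivZ !dX /=.
by rewrite !scaler0 addr0 add0r -!scalerAr !mulr1.
Qed.

Lemma vf_applyDl theta eta f :
  vf_apply (theta + eta) f = vf_apply theta f + vf_apply eta f.
Proof.
by rewrite -big_split; apply: eq_bigr => i _; rewrite mxE mulrDl.
Qed.

Lemma vf_applyZl p theta f : vf_apply (p *: theta) f = p * vf_apply theta f.
Proof.
by rewrite mulr_sumr; apply: eq_bigr => i _; rewrite mxE mulrA.
Qed.

Lemma vf_applyZr c theta f : vf_apply theta (c *: f) = c *: vf_apply theta f.
Proof.
by rewrite scaler_sumr; apply: eq_bigr => i _; rewrite mderivZ scalerAr.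
Qed.

Lemma vf_apply_homog n theta a b : (forall i, theta ord0 i \is n.-homog) ->
  vf_apply theta (linform a b) \is n.-homog.
Proof. by move=> h; rewrite vf_applyE rpredD // rpredZ. Qed.

Lemma log_vfieldD mu theta eta :
  log_vfield mu theta -> log_vfield mu eta -> log_vfield mu (theta + eta).
Proof.
move=> h1 h2 f hf f0; rewrite vf_applyDl.
by apply: mdvdD; [apply: h1 | apply: h2].
Qed.

Lemma log_vfieldZ mu p theta :
  log_vfield mu theta -> log_vfield mu (p *: theta).
Proof.
by move=> h f hf f0; rewrite vf_applyZl; apply: mdvd_mull; apply: h.
Qed.

(** Every other form with the same kernel is a nonzero scalar multiple of
[alpha], so the condition at [alpha] alone decides. *)
Lemma log_vfield_incr mu theta a b (alpha := linform a b) : alpha != 0 ->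
  log_vfield (incr_mult mu (ker_form alpha)) theta <->
  log_vfield mu theta /\
  mdvd (alpha ^+ (mu (ker_form alpha)).+1) (vf_apply theta alpha).
Proof.
move=> a0; rewrite /incr_mult; split=> [h | [h [q hq]]].
  split=> [f hf f0|].
    have [q] := h f hf f0; rewrite fsfun_withE; case: eqP => [<-|_] ->.
      by exists (q * f); rewrite exprS mulrA.
    by exists q.
  by have := h alpha (dhomog_linform a b) a0; rewrite fsfun_with.
move=> f hf f0; rewrite fsfun_withE; case: eqP => [kE|_]; last exact: h.
have [c c0 ->] := ker_form_inj a0 hf f0 kE.
apply: mdvd_scaleXl => //; rewrite vf_applyZr -mul_mpolyC.
by apply: mdvd_mull; exists q.
Qed.

Lemma log_basis_sym mu theta eta :
  log_basis mu theta eta -> log_basis mu eta theta.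
Proof.
move=> [h1 h2 hs hi]; split=> // [x /hs[p [q ->]] | p q].
  by exists q, p; rewrite addrC.
by rewrite addrC => /hi[-> ->].
Qed.

Lemma log_basis_shear mu p theta eta :
  log_basis mu theta eta -> log_basis mu (theta - p *: eta) eta.
Proof.
move=> [h1 h2 hs hi]; split=> // [|x /hs[r [q ->]] | r q].
- by rewrite -scaleNr; apply: log_vfieldD => //; apply: log_vfieldZ.
- exists r, (q + r * p).
  by rewrite scalerBr scalerDl scalerA -addrA [- _ + _]addrC addrK.
rewrite scalerBr scalerA -addrA -scaleNr -scalerDl => /hi[-> ].
by rewrite mul0r oppr0 add0r.
Qed.

Lemma log_basis_neq0 mu theta eta : log_basis mu theta eta -> theta != 0.
Proof.
move=> [_ _ _ hi]; apply/eqP => t0.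
have /hi[/eqP] : (1 : {mpoly K[2]}) *: theta + 0 *: eta = 0.
  by rewrite t0 scaler0 scale0r addr0.
by rewrite oner_eq0.
Qed.

(** If [p *: theta + q *: eta] satisfies the stronger condition, then so does
[q *: eta]; since [alpha] is prime and does not divide
[eta(alpha) / alpha ^+ m], it divides [q]. *)
Lemma log_basis_incr mu a b (alpha := linform a b) theta eta :
  alpha != 0 -> log_basis mu theta eta ->
  mdvd (alpha ^+ (mu (ker_form alpha)).+1) (vf_apply theta alpha) ->
  ~ mdvd (alpha ^+ (mu (ker_form alpha)).+1) (vf_apply eta alpha) ->
  log_basis (incr_mult mu (ker_form alpha)) theta (alpha *: eta).
Proof.
move=> a0 [h1 h2 hs hi] d1 d2.
have [g hg] := h2 alpha (dhomog_linform a b) a0.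
split.
- by apply/log_vfield_incr.
- apply/log_vfield_incr => //; split; first exact: log_vfieldZ.
  by exists g; rewrite vf_applyZl hg exprS mulrCA.
- move=> x /log_vfield_incr[//|/hs[p [q ->]]].
  rewrite vf_applyDl !vf_applyZl => /(mdvdDl (mdvd_mull p d1)).
  rewrite hg mulrA => /(mdvd_expS a0).
  case/linform_prime => // [[q' ->]|[g' gE]].
    by exists p, q'; rewrite scalerA.
  by case: d2; exists g'; rewrite hg gE exprS mulrA.
move=> p q; rewrite scalerA => /hi[-> /eqP].
by rewrite mulf_eq0 (negPf a0) orbF => /eqP->.
Qed.

(** * Homogeneous components and degrees of a basis *)

Lemma pihomogMr n k p f : f \is k.-homog ->
  pihomog mdeg n (p * f) =
  if (k <= n)%N then pihomog mdeg (n - k) p * f else 0.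
Proof.
move=> hf; elim/mpolyind: p => [|c m p _ _ IHp].
  by rewrite mul0r !linear0 mul0r if_same.
rewrite mulrDl linearD /= IHp linearD mulrDl /= -scalerAl !linearZ /= pihomogX.
have hX : 'X_[m] * f \is (mdeg m + k).-homog.
  by apply: dhomogM => //; rewrite dhomogX.
have [e|ne] := eqVneq (mdeg m + k)%N n.
  rewrite pihomog_dE; last by rewrite -e.
  by rewrite -e leq_addl addnK eqxx -scalerAl.
rewrite (pihomog_ne0 ne hX) scaler0 add0r; case: leqP => // lekn.
rewrite ifF ?scaler0 ?mul0r ?add0r //; apply: contraNF ne => /eqP /= ->.
by rewrite subnK.
Qed.

Lemma dhomog_divr n k p f : f != 0 -> f \is k.-homog -> p * f \is n.-homog ->
  p \is (n - k).-homog.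
Proof.
move=> f0 hf hpf; have := pihomogMr n p hf; rewrite pihomog_dE //.
case: leqP => [lekn /(mulIf f0) -> | _ /eqP]; first exact: pihomogP.
by rewrite mulf_eq0 (negPf f0) orbF => /eqP->; apply: dhomog0.
Qed.

(** As [g] is homogeneous too, its divisibility by the form is read off at a
single point: this is what turns the order of contact of [theta] with the line
into the vanishing of one scalar. *)
Lemma log_order_root a b (alpha := linform a b) theta n g m :
  alpha != 0 -> (forall i, theta ord0 i \is n.-homog) ->
  vf_apply theta alpha = g * alpha ^+ m ->
  mdvd (alpha ^+ m.+1) (vf_apply theta alpha) <->
  g.@[zero_dir a b ord0] = 0.
Proof.
move=> a0 htheta thetaE; rewrite -(@homog_dvd_root a b g (n - m)) //.
  rewrite thetaE; split; first exact: mdvd_expS.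
  by move=> [r ->]; exists r; rewrite exprS mulrA.
apply: (@dhomog_divr n m g (alpha ^+ m)); first by rewrite expf_neq0.
  by have := dhomogMn m (dhomog_linform a b); rewrite mul1n.
by rewrite -thetaE vf_apply_homog.
Qed.

(** Taking homogeneous components of the coefficients of [eta] on the basis
leaves no room for a basis element of degree greater than that of [eta]. *)
Lemma homog_coordinates mu theta1 theta2 n1 n2 n eta :
  homog_basis mu theta1 theta2 n1 n2 -> log_vfield mu eta ->
  (forall i, eta ord0 i \is n.-homog) ->
  exists p q, [/\ eta = p *: theta1 + q *: theta2,
    (n < n1)%N -> p = 0 & (n < n2)%N -> q = 0].
Proof.
move=> [[_ _ hs _] [_ h1] [_ h2]] /hs[p [q e]] he.
exists (if (n1 <= n)%N then pihomog mdeg (n - n1) p else 0).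
exists (if (n2 <= n)%N then pihomog mdeg (n - n2) q else 0).
split; first last.
- by rewrite (leqNgt n2) => ->.
- by rewrite (leqNgt n1) => ->.
apply/rowP=> i; rewrite -[LHS](pihomog_dE (he i)) {1}e !mxE linearD /=.
rewrite (pihomogMr _ _ (h1 i)) (pihomogMr _ _ (h2 i)).
by congr (_ + _); case: ifP; rewrite ?mul0r.
Qed.

Lemma homog_basis_sym mu theta1 theta2 n1 n2 :
  homog_basis mu theta1 theta2 n1 n2 -> homog_basis mu theta2 theta1 n2 n1.
Proof. by move=> [/log_basis_sym]. Qed.

(** If [n1] exceeded [e1], then both coordinates of [eta1] on the first basis
would be zero; if [n2] exceeded [e2], then both [eta1] and [eta2] would be multiples of
[theta1], hence dependent. *)
Lemma homog_basis_degree_le mu theta1 theta2 n1 n2 eta1 eta2 e1 e2 :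
  homog_basis mu theta1 theta2 n1 n2 -> homog_basis mu eta1 eta2 e1 e2 ->
  (n1 <= n2)%N -> (e1 <= e2)%N -> (n1 <= e1)%N /\ (n2 <= e2)%N.
Proof.
move=> ht he len lee; have [hb [eta1n0 h1] [_ h2]] := he.
have [l1 l2 _ hi] := hb.
have [p1 [q1 [E1 p10 q10]]] := homog_coordinates ht l1 h1.
have [p2 [q2 [E2 p20 q20]]] := homog_coordinates ht l2 h2.
split; rewrite leqNgt; apply/negP => lt.
  case/eqP: eta1n0; rewrite E1 p10 // q10 ?(leq_trans lt) //.
  by rewrite !scale0r addr0.
have q20' := q20 lt; have q10' := q10 (leq_ltn_trans lee lt).
have /hi[p20' /eqP] : p2 *: eta1 + (- p1) *: eta2 = 0.
  by rewrite E1 E2 q20' q10' !scale0r !addr0 !scalerA mulrC mulNr scaleNr subrr.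
rewrite oppr_eq0 => /eqP p10'.
by case/eqP: eta1n0; rewrite E1 p10' q10' !scale0r addr0.
Qed.

Lemma homog_basis_degree_gap mu theta1 theta2 n1 n2 eta1 eta2 e1 e2 :
  homog_basis mu theta1 theta2 n1 n2 -> homog_basis mu eta1 eta2 e1 e2 ->
  `|n1%:Z - n2%:Z|%N = `|e1%:Z - e2%:Z|%N.
Proof.
wlog len : theta1 theta2 n1 n2 / (n1 <= n2)%N => [gap ht he|].
  case/orP: (leq_total n1 n2) => len; first exact: gap ht he.
  by rewrite distnC; apply: gap (homog_basis_sym ht) he.
wlog lee : eta1 eta2 e1 e2 / (e1 <= e2)%N => [gap ht he|ht he].
  case/orP: (leq_total e1 e2) => lee; first exact: gap ht he.
  by rewrite [RHS]distnC; apply: gap ht (homog_basis_sym he).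
have [le1 le2] := homog_basis_degree_le ht he len lee.
have [ge1 ge2] := homog_basis_degree_le he ht lee len.
lia.
Qed.

(** * Strict inclusion after an increment *)

(** [Q] is the product, over the lines [H] in [r] other than the kernel of
[alpha], of an equation of [H] to the power [mu H]; it is prime to [alpha]
because distinct lines have non-associated equations. *)
Lemma coprime_support mu a b (alpha := linform a b)
    (r : seq {vspace 'rV[K]_2}) :
  alpha != 0 -> (forall H, H \in r -> \dim H = 1%N) ->
  exists Q, ~ mdvd alpha Q /\
    forall f, f \is 1.-homog -> f != 0 ->
      ker_form f \in r -> ker_form f != ker_form alpha ->
      mdvd (f ^+ mu (ker_form f)) Q.
Proof.
move=> a0; elim: r => [|H r IHr] dimr.
  exists 1; split=> // [[q /(congr1 (fun f => f.@[zero_dir a b ord0]))]].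
  by rewrite mevalM meval_zero_dir mulr0 meval1 => /eqP; rewrite oner_eq0.
have dimr' H' : H' \in r -> \dim H' = 1%N.
  by move=> rH'; apply: dimr; rewrite inE rH' orbT.
have [Q [ndQ dQ]] := IHr dimr'.
have [c [e [g0 HE]]] := line_ker_form (dimr H (mem_head _ _)).
set g := linform c e in g0 HE.
have [HA|HA] := eqVneq H (ker_form alpha).
  exists Q; split=> // f hf f0; rewrite inE HA => /orP[/eqP-> /negP[]//|].
  exact: dQ.
exists (g ^+ mu H * Q); split.
  elim: (mu H) => [|k IHk]; first by rewrite mul1r.
  rewrite exprS -mulrA => /linform_prime[]// dg.
  case/eqP: HA; rewrite HE; apply: ker_form_dvd => //.
  exact: dhomog_linform.
move=> f hf f0; rewrite inE => /orP[/eqP fH _|fr fA]; last first.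
  by apply: mdvd_mull; apply: dQ.
have [k k0 fE] := ker_form_inj g0 hf f0 (etrans fH HE).
by rewrite fH fE; apply: mdvd_scaleXl => //; exists Q; rewrite mulrC.
Qed.

(** The witness is the constant derivation sending [alpha] to 1, multiplied by
[alpha ^+ m] and by the polynomial [Q] of [coprime_support]. *)
Lemma incr_mult_proper mu a b (alpha := linform a b) :
  multiarrangement mu -> alpha != 0 ->
  exists2 theta, log_vfield mu theta &
    ~ mdvd (alpha ^+ (mu (ker_form alpha)).+1) (vf_apply theta alpha).
Proof.
move=> hmu a0; set m := mu _.
have [Q [ndQ dQ]] := coprime_support mu (r := finsupp mu) a0 hmu.
have [s [t e]] := linform_complement a0.
pose u : vfield K := \row_i (tnth [tuple - t; s] i)%:MP.
exists ((alpha ^+ m * Q) *: u) => [f hf f0|].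
  rewrite vf_applyZl mulrC; apply: mdvd_mull.
  have [fA|fA] := eqVneq (ker_form f) (ker_form alpha).
    have [c c0 ->] := ker_form_inj a0 hf f0 fA.
    rewrite ker_formZ ?dhomog_linform //; apply: mdvd_scaleXl => //.
    by exists Q; rewrite mulrC.
  apply: mdvd_mull; have [fm|fm] := boolP (ker_form f \in finsupp mu).
    exact: dQ.
  by exists Q; rewrite fsfun_dflt // expr0 mulr1.
rewrite vf_applyZl vf_applyE !mxE /= => -[q].
rewrite (_ : _ + _ = 1); last first.
  rewrite -!mul_mpolyC -!mpolyCM -mpolyCD -mpolyC1 -e; congr (_%:MP).
  rewrite /tnth /=; ring.
rewrite mulr1 mulrC => E; apply: ndQ.
by apply: (mdvd_expS (m := m) a0); exists q.
Qed.

(** * Homogeneous bases after an increment *)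

Lemma homog_basis_incr mu a b (alpha := linform a b) theta eta k n :
  alpha != 0 -> homog_basis mu theta eta k n ->
  mdvd (alpha ^+ (mu (ker_form alpha)).+1) (vf_apply theta alpha) ->
  ~ mdvd (alpha ^+ (mu (ker_form alpha)).+1) (vf_apply eta alpha) ->
  homog_basis (incr_mult mu (ker_form alpha)) theta (alpha *: eta) k n.+1.
Proof.
move=> a0 [hb ht [_ he]] d1 d2; have hb' := log_basis_incr a0 hb d1 d2.
split=> //; split; first exact: log_basis_neq0 (log_basis_sym hb').
by move=> i; rewrite mxE; apply: (dhomogM (d := 1)) (dhomog_linform a b) (he i).
Qed.

Lemma homog_basis_shear mu p theta eta k n :
  homog_basis mu theta eta k n -> p \is (k - n).-homog -> (n <= k)%N ->
  homog_basis mu (theta - p *: eta) eta k n.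
Proof.
move=> [hb [_ ht] [e0 he]] hp lenk; have hb' := log_basis_shear p hb.
split=> //; split; first exact: log_basis_neq0 hb'.
move=> i; rewrite !mxE rpredB //.
by have := dhomogM hp (he i); rewrite subnK.
Qed.

End LogFields.

Theorem corollary4p1 (K : fieldType)
    (mu : {fsfun {vspace 'rV[K]_2} -> nat with 0%N})
    (hmu : multiarrangement mu)
    (theta1 theta2 : vfield K) (n1 n2 : nat)
    (hbasis : homog_basis mu theta1 theta2 n1 n2)
    (hdeg : (n2 <= n1)%N)
    (ax ay : K) (alpha : {mpoly K[2]})
    (halpha : alpha = ax *: 'X_ord0 + ay *: 'X_ord_max)
    (halpha0 : alpha != 0)
    (theta1' theta2' : vfield K) (n1' n2' : nat)
    (hbasis' :
      homog_basis (incr_mult mu (ker_form alpha)) theta1' theta2' n1' n2')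
    (d d' : nat)
    (hd : d = `|n1%:Z - n2%:Z|%N)
    (hd' : d' = `|n1'%:Z - n2'%:Z|%N)
    (g : {mpoly K[2]})
    (hg : vf_apply theta2 alpha = g * alpha ^+ mu (ker_form alpha)) :
  (g.@[tnth [tuple ay; - ax]] = 0 \/ d = 0%N -> (d < d')%N) /\
  (~ (g.@[tnth [tuple ay; - ax]] = 0 \/ d = 0%N) -> (d' < d)%N).
Proof.
rewrite -[_ + _]/(linform ax ay) in halpha.
rewrite halpha in halpha0 hbasis' hg; clear alpha halpha.
set alpha := linform ax ay in halpha0 hbasis' hg.
set m := mu _ in hg.
have -> : g.@[tnth [tuple ay; - ax]] = g.@[zero_dir ax ay ord0].
  by apply: meval_eq => i; rewrite mxE.
have [hb [_ h1] [_ h2]] := hbasis.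
have [g1 hg1] : exists g1, vf_apply theta1 alpha = g1 * alpha ^+ m.
  by have [l1 _ _ _] := hb; apply: l1 (dhomog_linform ax ay) halpha0.
have root_g := log_order_root halpha0 h2 hg.
have [r0|r0] := eqVneq g.@[zero_dir ax ay ord0] 0.
  have dvd2 : mdvd (alpha ^+ m.+1) (vf_apply theta2 alpha) by apply/root_g.
  have ndvd1 : ~ mdvd (alpha ^+ m.+1) (vf_apply theta1 alpha).
    move=> dvd1; have [theta ltheta] := incr_mult_proper hmu halpha0; apply.
    have [_ _ hs _] := hb; have [p [q ->]] := hs theta ltheta.
    by rewrite vf_applyDl !vf_applyZl; apply: mdvdD; apply: mdvd_mull.
  have hbasis1 :=
    homog_basis_incr halpha0 (homog_basis_sym hbasis) dvd2 ndvd1.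
  have := homog_basis_degree_gap hbasis' hbasis1.
  by rewrite -hd' => ->; split=> [_|[]]; [rewrite hd; lia | left].
have ndvd2 : ~ mdvd (alpha ^+ m.+1) (vf_apply theta2 alpha).
  by move=> /root_g /eqP; apply/negP.
have [s [t e]] := linform_complement halpha0.
(* the scalar is forced by [g1 - h * g] vanishing at [zero_dir ax ay], where
   [linform s t] equals 1 *)
pose h := (g1.@[zero_dir ax ay ord0] / g.@[zero_dir ax ay ord0]) *:
  linform s t ^+ (n1 - n2).
have hh : h \is (n1 - n2).-homog.
  apply: rpredZ; have := dhomogMn (n1 - n2) (dhomog_linform s t).
  by rewrite mul1n.
have hbasis2 := homog_basis_shear hbasis hh hdeg.
have dvd1 : mdvd (alpha ^+ m.+1) (vf_apply (theta1 - h *: theta2) alpha).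
  have [_ [_ heta] _] := hbasis2.
  apply/(@log_order_root _ _ _ _ n1 (g1 - h * g) m halpha0 heta).
    by rewrite -scaleNr vf_applyDl vf_applyZl hg1 hg mulrA mulNr mulrBl mulNr.
  rewrite mevalB mevalM mevalZ rmorphXn /= meval_linform !zero_dirE mulrN e.
  by rewrite expr1n mulr1 divfK ?subrr.
have hbasis1 := homog_basis_incr halpha0 hbasis2 dvd1 ndvd2.
have := homog_basis_degree_gap hbasis' hbasis1.
rewrite -hd' => ->; split=> [[/eqP|]|nd]; first by rewrite (negPf r0).
  by rewrite hd; lia.
have : d <> 0%N by move=> d0; apply: nd; right.
by rewrite hd; lia.
Qed.
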